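(* Let $x$ be the $N$-dimensional linear diffusion ${\rm d}x=Ax\,{\rm d}t+B\,{\rm d}w$, where $A,B$ are constant matrices and $w$ is a standard vector Wiener process. Let $\{P_i\}$ be a finite set of symmetric $N\times N$ matrices such that for every non-zero symmetric $N\times N$ matrix $Z$ there is an $i$ with ${\rm Tr}\{P_iZ\}>0$. Then, for each $i$, the minimal symmetric matrix $Q_i$ and scalar $q_i$ satisfying $$e'A'P_ie+e'P_iAe+{\rm Tr}\{B'P_iB\}-e'Q_ie-q_i\le 0\qquad\text{for all } e\in\mathbb{R}^N$$ are $$Q_i=A'P_i+P_iA,\qquad q_i={\rm Tr}\{B'P_iB\}.$$ With these $Q_i$ and $q_i$, the inequalities $${\rm Tr}\{P_i\dot\Sigma\}\le{\rm Tr}\{Q_i\Sigma\}+q_i\qquad\text{for all } i$$ for the mean square error matrix $\Sigma$ and its time derivative $\dot\Sigma$ imply $$\dot\Sigma=\Sigma A'+A\Sigma+BB',$$ that is, the exact covariance propagation equation of the conventional Kalman filter.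
   Context: The symbol $'$ denotes transpose. Between observations the estimate $\tilde x$ evolves by ${\rm d}\tilde x=A\tilde x\,{\rm d}t$, the estimation error is $\tilde e=\tilde x-x$, and $\Sigma(t)={\rm E}\{\tilde e(t)\tilde e(t)'\}$ is the (symmetric) mean square error matrix, with time derivative $\dot\Sigma$. ''Minimal'' means that any other symmetric $Q$ and scalar $q$ satisfying the displayed inequality for all $e$ (for the same $P_i$) have $Q-Q_i$ positive semi-definite and $q\ge q_i$. *)

(* Defs.v *)
From HB Require Import structures.
From mathcomp Require Import all_boot all_order all_algebra.
From mathcomp Require Import all_classical all_reals all_analysis.

Set Implicit Arguments.
Unset Strict Implicit.
Unset Printing Implicit Defensive.

Import Order.TTheory GRing.Theory Num.Theory.
Import numFieldNormedType.Exports.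

Local Open Scope classical_set_scope.
Local Open Scope ring_scope.

Definition qform (R : realType) (n : nat) (M : 'M[R]_n) (e : 'cV[R]_n) : R :=
  (e^T *m M *m e) 0 0.

Definition psd (R : realType) (n : nat) (M : 'M[R]_n) : Prop :=
  M \is symmetricmx /\ forall e : 'cV[R]_n, 0 <= qform M e.

Definition bounds (R : realType) (n m : nat) (A : 'M[R]_n) (B : 'M[R]_(n, m))
    (P Q : 'M[R]_n) (q : R) : Prop :=
  forall e : 'cV[R]_n,
    qform (A^T *m P) e + qform (P *m A) e + \tr (B^T *m P *m B)
      - qform Q e - q <= 0.

Definition minimal_bounds (R : realType) (n m : nat) (A : 'M[R]_n)
    (B : 'M[R]_(n, m)) (P Q : 'M[R]_n) (q : R) : Prop :=
  [/\ Q \is symmetricmx, bounds A B P Q q &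
      forall (Q' : 'M[R]_n) (q' : R),
        Q' \is symmetricmx -> bounds A B P Q' q' -> psd (Q' - Q) /\ q <= q'].

(* Vector processes have time set [0, +oo[; their values at negative times are
   irrelevant. *)
Section processes.
Context (d : measure_display) (T : measurableType d) (R : realType)
        (Pr : probability T R).

Record filtration (F : R -> set (set T)) : Prop := {
  filtration_sigma_algebra : forall t, 0 <= t -> sigma_algebra setT (F t) ;
  filtration_measurable : forall t, 0 <= t -> F t `<=` measurable ;
  filtration_nondecreasing : forall s t, 0 <= s -> s <= t -> F s `<=` F t }.

Definition adapted (n : nat) (F : R -> set (set T)) (X : R -> T -> 'cV[R]_n) :=
  forall t, 0 <= t -> forall (k : 'I_n) (U : set R), measurable U ->
    F t [set w | U (X t w k 0)].

Definition continuous_paths (n : nat) (X : R -> T -> 'cV[R]_n) :=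
  {ae Pr, forall w, {within `[0, +oo[, continuous (fun t => X t w)}}.

(* The product formula says at once that, for s < t, the increment W t - W s is
   independent of F s, that its coordinates are independent, and that each of
   them is centred normal with variance t - s (normal_prob takes the standard
   deviation). *)
Record standard_wiener (m : nat) (F : R -> set (set T))
    (W : R -> T -> 'cV[R]_m) : Prop := {
  wiener_filtration : filtration F ;
  wiener_adapted : adapted F W ;
  wiener_continuous : continuous_paths W ;
  wiener0 : {ae Pr, forall w, W 0 w = 0} ;
  wiener_increments : forall (s t : R), 0 <= s -> s < t ->
    forall (E : set T) (U : 'I_m -> set R),
      F s E -> (forall k, measurable (U k)) ->
      Pr (E `&` [set w | forall k, U k (W t w k 0 - W s w k 0)]) =
      (Pr E * \prod_(k < m) normal_prob 0 (Num.sqrt (t - s)) (U k))%E }.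

(* dx = A x dt + B dW: as B is constant, the stochastic integral of B against W
   over [0, t] is B (W t - W 0), and W 0 = 0 almost surely. *)
Record linear_diffusion (n m : nat) (A : 'M[R]_n) (B : 'M[R]_(n, m))
    (F : R -> set (set T)) (W : R -> T -> 'cV[R]_m)
    (x : R -> T -> 'cV[R]_n) : Prop := {
  diffusion_wiener : standard_wiener F W ;
  diffusion_adapted : adapted F x ;
  diffusion_continuous : continuous_paths x ;
  diffusion_eq : {ae Pr, forall w, forall t, 0 <= t -> forall k : 'I_n,
    x t w k 0 = x 0 w k 0
      + \int[lebesgue_measure]_(s in `[0, t]) ((A *m x s w) k 0)
      + (B *m W t w) k 0} }.

Definition estimate_evolves (n : nat) (A : 'M[R]_n) (t0 t1 : R)
    (xh : R -> T -> 'cV[R]_n) : Prop :=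
  {ae Pr, forall w, forall t : R, t0 < t < t1 ->
    is_derive t (1 : R) (fun s => xh s w) (A *m xh t w)}.

Definition estimation_error (n : nat) (xh x : R -> T -> 'cV[R]_n)
    (t : R) (w : T) : 'cV[R]_n := xh t w - x t w.

Definition square_integrable (n : nat) (e : T -> 'cV[R]_n) : Prop :=
  forall k : 'I_n, (fun w => e w k 0) \in Lfun Pr 2%:E.

Definition mse (n : nat) (e : R -> T -> 'cV[R]_n) (t : R) : 'M[R]_n :=
  \matrix_(i, j) fine ('E_Pr[fun w => (e t w *m (e t w)^T) i j])%E.

End processes.

(* Main.v *)
Require Import Defs.
From HB Require Import structures.
From mathcomp Require Import all_boot all_order all_algebra.
From mathcomp Require Import all_classical all_reals all_analysis.
From mathcomp Require Import ring lra.

Import Order.TTheory GRing.Theory Num.Theory.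
Import numFieldNormedType.Exports.

Local Open Scope classical_set_scope.
Local Open Scope ring_scope.

(** Both halves are linear algebra of symmetric matrices and the trace pairing.

    Minimality.  Put [Q0 = A^T *m P + P *m A] and [q0 = \tr (B^T *m P *m B)].
    The inequality defining [bounds] says that the quadratic form of [Q0 - Q]
    is at most the constant [q - q0].  A quadratic form bounded above is
    nonpositive, since it scales quadratically ([qform_le_cst]); so [Q - Q0] is
    positive semi-definite, and the value at 0 gives [q0 <= q].  Hence
    [(Q0, q0)] is minimal.  If [(Q, q)] is minimal too, then the two
    semi-definiteness statements make the form of [Q0 - Q] vanish, and a
    symmetric matrix is determined by its quadratic form ([sym_qform_eq0]).

    Propagation.  The maps [P |-> A^T *m P + P *m A] and
    [S |-> S *m A^T + A *m S] are adjoint for the trace pairing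
    ([trace_adjoint]).  So, for [Z] the difference of the two sides of the
    covariance equation, the assumed inequalities say exactly that
    [\tr (P i *m Z) <= 0] for all [i].  As [Z] is symmetric
    ([mse_sym], [derive1_sym]), the hypothesis on the [P i] forces [Z = 0]. *)

Set Implicit Arguments.
Unset Strict Implicit.

Lemma symmetricmxP (R : fieldType) (n : nat) (M : 'M[R]_n) :
  reflect (M^T = M) (M \is symmetricmx).
Proof.
by rewrite qualifE /= expr0 scale1r map_mx_id // eq_sym; apply: eqP.
Qed.

Lemma symmetricmxB (R : fieldType) (n : nat) (M M' : 'M[R]_n) :
  M \is symmetricmx -> M' \is symmetricmx -> M - M' \is symmetricmx.
Proof.
move=> /symmetricmxP sM /symmetricmxP sM'; apply/symmetricmxP.
by rewrite linearB /= sM sM'.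
Qed.

Lemma symmetricmx_lyapunov (R : fieldType) (n : nat) (A P : 'M[R]_n) :
  P \is symmetricmx -> A^T *m P + P *m A \is symmetricmx.
Proof.
move=> /symmetricmxP sP; apply/symmetricmxP.
by rewrite linearD /= !trmx_mul trmxK sP addrC.
Qed.

Lemma qformD (R : realType) (n : nat) (M M' : 'M[R]_n) (e : 'cV[R]_n) :
  qform (M + M') e = qform M e + qform M' e.
Proof. by rewrite /qform mulmxDr mulmxDl mxE. Qed.

Lemma qformB (R : realType) (n : nat) (M M' : 'M[R]_n) (e : 'cV[R]_n) :
  qform (M - M') e = qform M e - qform M' e.
Proof. by rewrite /qform mulmxBr mulmxBl !mxE. Qed.

Lemma qform_at0 (R : realType) (n : nat) (M : 'M[R]_n) : qform M 0 = 0.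
Proof. by rewrite /qform mulmx0 mxE. Qed.

Lemma qform_scale (R : realType) (n : nat) (M : 'M[R]_n) (a : R)
    (e : 'cV[R]_n) :
  qform M (a *: e) = a ^+ 2 * qform M e.
Proof.
by rewrite /qform -scalemxAr linearZ -!scalemxAl !mxE mulrA expr2.
Qed.

Lemma qform_delta_add (R : realType) (n : nat) (M : 'M[R]_n) (i j : 'I_n) :
  qform M (delta_mx i 0 + delta_mx j 0) = M i i + M i j + M j i + M j j.
Proof.
rewrite /qform mulmxDr linearD /= !trmx_delta !mulmxDl -!rowE -!colE !mxE.
ring.
Qed.

(** Polarization: the values at sums of two basis vectors recover all the
    entries. *)
Lemma sym_qform_eq0 (R : realType) (n : nat) (M : 'M[R]_n) :
  M \is symmetricmx -> (forall e, qform M e = 0) -> M = 0.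
Proof.
move=> /symmetricmxP sM M0.
have diag i : M i i = 0.
  by have := M0 (delta_mx i 0 + delta_mx i 0); rewrite qform_delta_add; lra.
apply/matrixP => i j; rewrite mxE.
have := M0 (delta_mx i 0 + delta_mx j 0).
have sij : M j i = M i j by rewrite -[in RHS]sM mxE.
by rewrite qform_delta_add sij !diag; lra.
Qed.

(** A positive value at [e] would make the form unbounded along the line
    spanned by [e]. *)
Lemma qform_le_cst (R : realType) (n : nat) (M : 'M[R]_n) (c : R) :
  (forall e, qform M e <= c) -> forall e, qform M e <= 0.
Proof.
move=> Mc e; rewrite leNgt; apply/negP => Me0.
have c0 : 0 <= c by have := Mc 0; rewrite qform_at0.
(* For u = c / qform M e >= 0, scaling by u + 1 gives a value above c,
   because u < (u + 1) ^+ 2. *)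
have := Mc ((c / qform M e + 1) *: e); rewrite qform_scale.
have u0 : 0 <= c / qform M e by rewrite divr_ge0 // ltW.
have : c / qform M e * qform M e = c by rewrite divfK // gt_eqF.
move: (c / qform M e) u0 => u u0 uc.
suff : u * qform M e < (u + 1) ^+ 2 * qform M e by rewrite uc; lra.
by rewrite ltr_pM2r //; nra.
Qed.

Lemma boundsE (R : realType) (n m : nat) (A : 'M[R]_n) (B : 'M[R]_(n, m))
    (P Q : 'M[R]_n) (q : R) :
  bounds A B P Q q <->
  forall e, qform (A^T *m P + P *m A - Q) e <= q - \tr (B^T *m P *m B).
Proof. by split=> h e; have := h e; rewrite qformB qformD; lra. Qed.

Lemma minimal_boundsP (R : realType) (n m : nat) (A : 'M[R]_n)
    (B : 'M[R]_(n, m)) (P Q : 'M[R]_n) (q : R) :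
  P \is symmetricmx ->
  minimal_bounds A B P Q q <->
  Q = A^T *m P + P *m A /\ q = \tr (B^T *m P *m B).
Proof.
move=> sP; have sQ0 := symmetricmx_lyapunov A sP.
have b0 : bounds A B P (A^T *m P + P *m A) (\tr (B^T *m P *m B)).
  by apply/boundsE => e; rewrite !subrr /qform mulmx0 mul0mx mxE.
split=> [[sQ /boundsE bQ minQ]|[-> ->]].
  have [[_ pQ] qle] := minQ _ _ sQ0 b0.
  split.
    apply/esym/subr0_eq/sym_qform_eq0 => [|e]; first exact: symmetricmxB.
    by have := bQ e; have := pQ e; lra.
  by have := bQ 0; rewrite qform_at0; lra.
split=> // Q' q' sQ' /boundsE bQ'; split; last first.
  by have := bQ' 0; rewrite qform_at0; lra.
split=> [|e]; first exact: symmetricmxB.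
by have := qform_le_cst bQ' e; rewrite !qformB; lra.
Qed.

Lemma derive_coord (R : realType) (m n : nat) (V : normedModType R)
    (f : V -> 'M[R]_(m, n)) (a v : V) (i : 'I_m) (j : 'I_n) :
  derivable f a v -> 'D_v (fun u => f u i j) a = ('D_v f a) i j.
Proof.
move=> df; apply: (cvg_lim (@norm_hausdorff _ _)).
apply: (cvg_trans _ (continuous_cvg _
  (@coord_continuous R m n i j ('D_v f a)) df)).
by apply: near_eq_cvg; apply: nearW => h; rewrite /= !mxE.
Qed.

Lemma derive1_sym (R : realType) (n : nat) (S : R -> 'M[R]_n) (t : R) :
  derivable S t 1 -> (forall s, S s \is symmetricmx) ->
  (S^`())%classic t \is symmetricmx.
Proof.
move=> dS sS; apply/symmetricmxP/matrixP => i j.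
rewrite mxE derive1E -!derive_coord //; congr (derive _ t 1).
apply/funext => s; have /symmetricmxP sSs := sS s.
by rewrite -[in LHS]sSs mxE.
Qed.

Lemma mse_sym (d : measure_display) (T : measurableType d) (R : realType)
    (Pr : probability T R) (n : nat) (e : R -> T -> 'cV[R]_n) (t : R) :
  mse Pr e t \is symmetricmx.
Proof.
apply/symmetricmxP/matrixP => i j; rewrite !mxE; congr (fine 'E_Pr[_])%E.
by apply/funext => w; rewrite !mxE !big_ord1 !mxE mulrC.
Qed.

(** Cyclicity of the trace moves the covariance dynamics from [S] onto [P];
    this is why the minimal bounds are the right-hand side of the exact
    equation, tested against [P]. *)
Lemma trace_adjoint (R : comNzRingType) (n m : nat) (A P S : 'M[R]_n)
    (B : 'M[R]_(n, m)) :
  \tr (P *m (S *m A^T + A *m S + B *m B^T)) =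
  \tr ((A^T *m P + P *m A) *m S) + \tr (B^T *m P *m B).
Proof.
rewrite !mulmxDr mulmxDl !mxtraceD; congr (_ + _ + _).
- by rewrite mulmxA mxtrace_mulC !mulmxA.
- by rewrite mulmxA.
- by rewrite mulmxA mxtrace_mulC !mulmxA.
Qed.

Unset Implicit Arguments.

Theorem mainTheorem2 (R : realType) (d : measure_display)
    (T : measurableType d) (Pr : probability T R) (N m : nat)
    (A : 'M[R]_N) (B : 'M[R]_(N, m))
    (F : R -> set (set T)) (W : R -> T -> 'cV[R]_m) (x : R -> T -> 'cV[R]_N)
    (hx : linear_diffusion Pr A B F W x)
    (I : finType) (P : I -> 'M[R]_N)
    (P_sym : forall i, P i \is symmetricmx)
    (P_pos : forall Z : 'M[R]_N, Z \is symmetricmx -> Z != 0 ->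
       exists i, 0 < \tr (P i *m Z)) :
  (forall i (Q : 'M[R]_N) (q : R),
     minimal_bounds A B (P i) Q q <->
     Q = A^T *m P i + P i *m A /\ q = \tr (B^T *m P i *m B)) /\
  (forall (t0 t1 : R) (xh : R -> T -> 'cV[R]_N),
     0 <= t0 ->
     estimate_evolves Pr A t0 t1 xh ->
     let e := estimation_error xh x in
     let Sigma := mse Pr e in
     (forall t : R, t0 < t < t1 -> square_integrable Pr (e t)) ->
     forall t : R, t0 < t < t1 -> derivable Sigma t 1 ->
     (forall i, \tr (P i *m (Sigma^`())%classic t) <=
        \tr ((A^T *m P i + P i *m A) *m Sigma t) + \tr (B^T *m P i *m B)) ->
     (Sigma^`())%classic t = Sigma t *m A^T + A *m Sigma t + B *m B^T).
Proof.
split=> [i Q q|t0 t1 xh _ _ e Sigma _ t _ dS lS]; first exact: minimal_boundsP.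
set D := (_^`())%classic t; set L := RHS.
have sS s : Sigma s \is symmetricmx by exact: mse_sym.
have sL : L \is symmetricmx.
  have /symmetricmxP sSt := sS t; apply/symmetricmxP.
  by rewrite /L !linearD /= !trmx_mul !trmxK sSt [A *m _ + _]addrC.
have sZ : D - L \is symmetricmx by apply: symmetricmxB => //; exact: derive1_sym.
(* D - L pairs to at most 0 with every P i, so it cannot be non-zero. *)
apply/subr0_eq/eqP/negPn/negP => /(P_pos _ sZ)[i].
by rewrite mulmxBr linearB /= subr_gt0 ltNge /L trace_adjoint lS.
Qed.
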